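(* Let $v^1, v^2 : \mathbb{X} \to [0,\infty)$ be two intensity functions (PHDs), each a finite Gaussian mixture with positive weights on $\mathbb{X}$, and let $\omega_1,\omega_2>0$ with $\omega_1+\omega_2=1$. Let $M_1, M_2, Q$ be nonnegative integers with $Q \le \min\{M_1,M_2\}$, and put $M = M_1+M_2-Q$. For $l=1,2$ let the Gaussian components of $v^l$ be grouped into $M_l$ disjoint clusters, giving the decomposition $$v^l(\mathbf{x}) = \sum_{p=1}^{M_l} \hat v^l_p(\mathbf{x}),$$ where $\hat v_p^l$ is the sum of the weighted Gaussian components in the $p$-th cluster. Let $\mathbb{X} = \mathbb{X}_1\cup\cdots\cup\mathbb{X}_M$ be a partition of $\mathbb{X}$ into pairwise disjoint (measurable) sets, and for $l=1,2$ and $p=1,\dots,M$ define $v_p^l(\mathbf{x}) = v^l(\mathbf{x})\,\mathbf{1}_{\mathbb{X}_p}(\mathbf{x})$. Let $\delta\ge 0$ be a scalar such that $$\begin{array}{ll} \|v_p^1-\hat v_p^1\|_\infty \le \delta & \text{for } p=1,\dots,M_1,\\ \|v_p^1\|_\infty\le\delta & \text{for } p=M_1+1,\dots,M,\\ \|v_p^2-\hat v_p^2\|_\infty\le\delta & \text{for } p=1,\dots,Q,\\ \|v_p^2\|_\infty\le\delta & \text{for } p=Q+1,\dots,M_1,\\ \|v_p^2-\hat v^2_{p-M_1+Q}\|_\infty\le\delta & \text{for } p=M_1+1,\dots,M. \end{array}$$ Suppose that $[v^1(\mathbf{x})]^{\omega_1}$ and $[v^2(\mathbf{x})]^{\omega_2}$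 are bounded, and let $$K = \max_{1\le p,q\le M}\left\{ \left\| [v_p^1]^{\omega_1}\right\|_1,\ \left\|[v_q^2]^{\omega_2}\right\|_1\right\}.$$ Let $$v^{1,2}(\mathbf{x}) = [v^1(\mathbf{x})]^{\omega_1}[v^2(\mathbf{x})]^{\omega_2}, \qquad \hat v^{1,2}(\mathbf{x}) = \sum_{p=1}^{Q} [\hat v_p^1(\mathbf{x})]^{\omega_1}[\hat v_p^2(\mathbf{x})]^{\omega_2}.$$ Then $$\left\|\hat v^{1,2}-v^{1,2}\right\|_1 \le M_2\,K\,\delta^{\omega_1} + (2Q+M_1)\,K\,\delta^{\omega_2}.$$
   Context: $\mathbb{X}$ is the single-target state space, a Euclidean space $\mathbb{R}^n$ with Lebesgue measure. A (finite) Gaussian mixture with positive weights is a function $\sum_{i=1}^N \alpha_i\,\mathcal{N}(\mathbf{x};\mathbf{x}_i,\mathbf{P}_i)$ with $\alpha_i>0$, where $\mathcal{N}(\cdot;\mathbf{x}_i,\mathbf{P}_i)$ is the Gaussian probability density with mean $\mathbf{x}_i$ and positive definite covariance $\mathbf{P}_i$; each term is called a Gaussian component. $\mathbf{1}_{\mathbb{X}_p}$ is the indicator function of $\mathbb{X}_p$. For $f:\mathbb{X}\to\mathbb{R}$, $\|f\|_\infty=\sup_{\mathbf{x}\in\mathbb{X}}|f(\mathbf{x})|$ and $\|f\|_1=\int_{\mathbb{X}}|f(\mathbf{x})|\,d\mathbf{x}$. Powers such as $[v]^{\omega}$ are taken pointwise. Interpretation of the indices: for $p\le Q$ the clusters $\hat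 v_p^1$ and $\hat v_p^2$ are matched to each other (and concentrated on $\mathbb{X}_p$); for $p=Q+1,\dots,M_1$ the cluster $\hat v_p^1$ is unmatched and concentrated on $\mathbb{X}_p$; for $p=M_1+1,\dots,M$ the cluster $\hat v^2_{p-M_1+Q}$ is unmatched and concentrated on $\mathbb{X}_p$. The scalar $\delta$ quantifies this concentration. $v^{1,2}$ is the exact Generalized Covariance Intersection fusion of the two PHDs and $\hat v^{1,2}$ is its parallelized approximation. *)

(* Defs.v *)
From HB Require Import structures.
From mathcomp Require Import all_boot all_order all_algebra.
From mathcomp Require Import all_classical all_reals all_analysis.
Import Order.TTheory GRing.Theory Num.Theory.
Import numFieldNormedType.Exports.
Set Implicit Arguments.
Unset Strict Implicit.
Unset Printing Implicit Defensive.
Local Open Scope classical_set_scope.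
Local Open Scope ring_scope.

(* The Euclidean space R^n is the type n.-tuple R; its library sigma-algebra,
   generated by the coordinate maps, is the Borel sigma-algebra of R^n. *)

Definition tcons (R : realType) n (p : measurableTypeR R * n.-tuple R) :
  n.+1.-tuple R := [tuple of (p.1 : R) :: p.2].

Section lebesgue_succ.
Context {R : realType} (n : nat).
Variable mu : {sigma_finite_measure set (n.-tuple R) -> \bar R}.
Local Open Scope ereal_scope.

Definition lebesgue_succ : set (n.+1.-tuple R) -> \bar R :=
  pushforward (lebesgue_measure \x mu) (@tcons R n).

Let measurable_tcons : measurable_fun setT (@tcons R n).
Proof. exact: measurable_cons. Qed.

Let lebesgue_succ0 : lebesgue_succ set0 = 0.
Proof. by rewrite /lebesgue_succ /pushforward preimage_set0 measure0. Qed.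

Let lebesgue_succ_ge0 A : 0 <= lebesgue_succ A.
Proof. exact: measure_ge0. Qed.

Let lebesgue_succ_sigma_additive : semi_sigma_additive lebesgue_succ.
Proof.
move=> F mF tF mUF; rewrite /lebesgue_succ /pushforward preimage_bigcup.
apply: measure_semi_sigma_additive.
- by move=> k; rewrite -[X in measurable X]setTI; exact: measurable_tcons.
- apply/trivIsetP => /= i j _ _ ij; rewrite -preimage_setI.
  by move/trivIsetP : tF => /(_ _ _ _ _ ij) ->//; rewrite preimage_set0.
- rewrite -preimage_bigcup -[X in measurable X]setTI.
  exact: measurable_tcons.
Qed.

HB.instance Definition _ := isMeasure.Build _ _ _ lebesgue_succ
  lebesgue_succ0 lebesgue_succ_ge0 lebesgue_succ_sigma_additive.

Let tuncons (t : n.+1.-tuple R) : measurableTypeR R * n.-tuple R :=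
  (thead t, [tuple of behead t]).

Let measurable_tuncons : measurable_fun setT tuncons.
Proof.
apply/measurable_fun_pair; first exact: measurable_tnth.
exact: measurable_behead.
Qed.

Let tconsK : cancel (@tcons R n) tuncons.
Proof. by move=> [x t]; congr pair; exact/val_inj. Qed.

Let lebesgue_succ_sigma_finite : sigma_finite setT lebesgue_succ.
Proof.
have /sigma_finiteP[F [FT ndF Foo]] := sigma_finiteT (@lebesgue_measure R).
have /sigma_finiteP[G [GT ndG Goo]] := sigma_finiteT mu.
exists (fun k => tuncons @^-1` (F k `*` G k)).
  apply/seteqP; split=> // t _.
  have [i _ Fi] : (\bigcup_k F k) (tuncons t).1 by rewrite -FT.
  have [j _ Gj] : (\bigcup_k G k) (tuncons t).2 by rewrite -GT.
  exists (maxn i j) => //; split.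
    by apply: (subsetPset _ _ (ndF _ _ (leq_maxl i j))).
  by apply: (subsetPset _ _ (ndG _ _ (leq_maxr i j))).
move=> k; have [mF Fk] := Foo k; have [mG Gk] := Goo k; split.
  by rewrite -[_ @^-1` _]setTI; apply: measurable_tuncons => //; exact: measurableX.
rewrite /lebesgue_succ /pushforward -comp_preimage.
rewrite (_ : _ \o _ = id); last by apply/funext => x /=; rewrite tconsK.
by rewrite preimage_id product_measure1E// lte_mul_pinfty// ge0_fin_numE.
Qed.

HB.instance Definition _ := Measure_isSigmaFinite.Build _ _ _ lebesgue_succ
  lebesgue_succ_sigma_finite.

End lebesgue_succ.

(* Lebesgue measure on R^n: iterated product of the Lebesgue measure on R,
   transported along R * R^n ~ R^(n+1); on the point R^0 it is the unit mass. *)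
Fixpoint lebesgue_tuple (R : realType) n :
    {sigma_finite_measure set (n.-tuple R) -> \bar R} :=
  match n with
  | 0 => \d_([tuple] : 0.-tuple R)
  | n'.+1 => lebesgue_succ (lebesgue_tuple R n')
  end.

Lemma lebesgue_tuple_box (R : realType) n (A : 'I_n -> set R) :
  (forall i, measurable (A i)) ->
  lebesgue_tuple R n [set t | forall i, A i (tnth t i)] =
  (\prod_(i < n) lebesgue_measure (A i))%E.
Proof.
elim: n A => [|n IH] A mA.
  by rewrite big_ord0 /= diracE mem_set//; case.
rewrite big_ord_recl -(IH (fun i => A (lift ord0 i))); last by move=> i; exact: mA.
have mB : measurable [set t : n.-tuple R | forall i, A (lift ord0 i) (tnth t i)].
  rewrite (_ : [set t | _] =
    \bigcap_(i in [set: 'I_n]) ((@tnth _ R ^~ i) @^-1` A (lift ord0 i))).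
    apply: fin_bigcap_measurable => // i _.
    by rewrite -[_ @^-1` _]setTI; exact: measurable_tnth.
  by apply/seteqP; split=> t /= tA i; [move=> _; exact: tA|exact: (tA i)].
rewrite /= /lebesgue_succ /pushforward -product_measure1E//; last exact: mA.
congr product_measure1; apply/seteqP; split=> -[x t] /=.
  move=> xtA; split; first exact: (xtA ord0).
  by move=> i; have := xtA (lift ord0 i); rewrite tnthS.
move=> [xA tA] i; case: (unliftP ord0 i) => [j ->|-> //].
by rewrite tnthS; exact: tA.
Qed.

Section gaussian.
Context {R : realType} (n : nat).

Definition posdefmx (P : 'M[R]_n) :=
  P^T = P /\ forall x : 'cV[R]_n, x != 0 -> 0 < (x^T *m P *m x) 0 0.

Definition gaussian_pdf (m : n.-tuple R) (P : 'M[R]_n) (x : n.-tuple R) : R :=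
  let y := \col_i (tnth x i - tnth m i) in
  (Num.sqrt ((2 * pi) ^+ n * \det P))^-1 *
  expR (- (y^T *m invmx P *m y) 0 0 / 2).

Record gaussian_mixture := GaussianMixture {
  gm_size : nat ;
  gm_weight : 'I_gm_size -> R ;
  gm_mean : 'I_gm_size -> n.-tuple R ;
  gm_cov : 'I_gm_size -> 'M[R]_n ;
  gm_weight_gt0 : forall i, 0 < gm_weight i ;
  gm_cov_posdef : forall i, posdefmx (gm_cov i) }.

Definition gm_component (v : gaussian_mixture) (i : 'I_(gm_size v))
    (x : n.-tuple R) : R :=
  gm_weight i * gaussian_pdf (gm_mean i) (gm_cov i) x.

Definition gm_fun (v : gaussian_mixture) (x : n.-tuple R) : R :=
  \sum_(i < gm_size v) gm_component i x.

(* A grouping of the components of v into M disjoint clusters is the map c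
   sending each component to its cluster; clusters are numbered from 0. *)
Definition gm_cluster (v : gaussian_mixture) M (c : 'I_(gm_size v) -> 'I_M)
    (p : nat) (x : n.-tuple R) : R :=
  \sum_(i | c i == p :> nat) gm_component i x.

Lemma gm_cluster_sum (v : gaussian_mixture) M (c : 'I_(gm_size v) -> 'I_M) x :
  gm_fun v x = \sum_(p < M) gm_cluster c p x.
Proof. by rewrite /gm_fun (partition_big c predT). Qed.

End gaussian.
Arguments gaussian_mixture : clear implicits.

Definition restr_fun (R : realType) n (f : n.-tuple R -> R)
    (X : set (n.-tuple R)) (x : n.-tuple R) : R := f x * \1_X x.

(* The pointwise supremum, as opposed to the essential supremum 'N[mu]_+oo. *)
Definition supnorm (R : realType) T (f : T -> R) : \bar R :=
  ereal_sup (range (fun x => `|f x|%:E)).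

Definition L1norm (R : realType) n (f : n.-tuple R -> R) : \bar R :=
  ('N[lebesgue_tuple R n]_1 [EFin \o f])%E.

(* Main.v *)
Require Import Defs.
From mathcomp Require Import all_boot all_order all_algebra.
From mathcomp Require Import all_classical all_reals all_analysis.
From mathcomp Require Import measurable_realfun lra.
Import Order.TTheory GRing.Theory Num.Theory.
Import numFieldNormedType.Exports.
Local Open Scope classical_set_scope.
Local Open Scope ring_scope.

(* Let A, B be the values of v^1, v^2 at x. Hoelder's inequality for finite sums
   gives hv^{1,2} <= v^{1,2} pointwise, so only v^{1,2} - hv^{1,2} has to be
   bounded from above. On X_q with q matched, keep only the q-th term of the
   sum and use |s^w - t^w| <= |s - t|^w, which gives the bound
   delta^w1 B^w2 + delta^w2 A^w1; on the other X_q drop the whole sum, one of A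
   and B being at most delta. Integrating piece by piece even gives
   M_2 K delta^w1 + M_1 K delta^w2. *)

(** * Real powers with exponents in $[0,1]$, and Hoelder's inequality for finite sums *)

Section powR_lemmas.
Context {R : realType}.
Implicit Types s t w d : R.

Lemma le_powR w s t : 0 <= w -> 0 <= s -> s <= t -> s `^ w <= t `^ w.
Proof.
move=> w0 s0 st; apply: ge0_ler_powR => //; rewrite nnegrE//.
exact: le_trans st.
Qed.

(** Put $u = s+t$. Each $x \in [0,u]$ satisfies $x = x^w x^{1-w} \le x^w u^{1-w}$; adding this for
    $x = s$ and $x = t$ and cancelling $u^{1-w}$ gives the claim when $u > 0$. *)
Lemma powR_subadd w s t : 0 <= w <= 1 -> 0 <= s -> 0 <= t ->
  (s + t) `^ w <= s `^ w + t `^ w.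
Proof.
move=> /andP[w0 w1] s0 t0.
have [/eqP st0|st0] := boolP (s + t == 0).
  have -> : s + t = s by lra.
  by rewrite lerDl powR_ge0.
have st_gt0 : 0 < s + t by rewrite lt_def st0 addr_ge0.
have split x : 0 <= x -> x = x `^ w * x `^ (1 - w).
  (* The exponents add up to $1 \ne 0$, so the law for sums of exponents also holds at [x = 0]. *)
  move=> x0; rewrite -powRD; first by rewrite addrC subrK powRr1.
  by rewrite addrC subrK oner_eq0.
have part x : 0 <= x -> x <= s + t -> x <= x `^ w * (s + t) `^ (1 - w).
  move=> x0 xst; rewrite [leLHS]split// ler_wpM2l ?powR_ge0//.
  by rewrite le_powR// subr_ge0.
rewrite -(ler_pM2r (powR_gt0 (1 - w) st_gt0)) -split ?(ltW st_gt0)// mulrDl.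
by rewrite lerD// part// ?lerDl ?lerDr.
Qed.

(** One-sided form of $|s^w - t^w| \le |s-t|^w$: monotonicity applied to $s \le t + d$, then
    subadditivity. *)
Lemma powR_le_addB w s t d : 0 <= w <= 1 -> 0 <= s -> 0 <= t -> s - t <= d ->
  0 <= d -> s `^ w <= t `^ w + d `^ w.
Proof.
move=> w01 s0 t0 std d0; apply: le_trans (powR_subadd _ _ _ w01 t0 d0).
by apply: le_powR => //; [case/andP: w01|lra].
Qed.

(** This is [hoelder2] for the conjugate exponents $1/w_1$ and $1/w_2$, applied to the powers
    $a_i^{w_1}$ and $b_i^{w_2}$; [powVK] undoes these powers. *)
Lemma hoelder_add w1 w2 (a1 a2 b1 b2 : R) : 0 < w1 -> 0 < w2 -> w1 + w2 = 1 ->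
  0 <= a1 -> 0 <= a2 -> 0 <= b1 -> 0 <= b2 ->
  a1 `^ w1 * b1 `^ w2 + a2 `^ w1 * b2 `^ w2 <=
  (a1 + a2) `^ w1 * (b1 + b2) `^ w2.
Proof.
move=> w1_gt0 w2_gt0 w12 a10 a20 b10 b20.
have powVK w x : 0 < w -> 0 <= x -> (x `^ w) `^ w^-1 = x.
  by move=> w0 x0; rewrite -powRrM divff ?gt_eqF// powRr1.
have := @hoelder2 _ (a1 `^ w1) (a2 `^ w1) (b1 `^ w2) (b2 `^ w2) w1^-1 w2^-1.
by rewrite !powVK// !invrK !invr_gt0; apply; rewrite ?powR_ge0.
Qed.

Lemma hoelder_sum w1 w2 (I : Type) (r : seq I) (a b : I -> R) :
  0 < w1 -> 0 < w2 -> w1 + w2 = 1 ->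
  (forall i, 0 <= a i) -> (forall i, 0 <= b i) ->
  \sum_(i <- r) a i `^ w1 * b i `^ w2 <=
  (\sum_(i <- r) a i) `^ w1 * (\sum_(i <- r) b i) `^ w2.
Proof.
move=> w1_gt0 w2_gt0 w12 a0 b0; elim: r => [|i r IH].
  by rewrite !big_nil mulr_ge0 ?powR_ge0.
rewrite !big_cons; apply: le_trans (hoelder_add _ _ _ _ _ _ _ _ _ _ _ _ _) => //.
- by rewrite lerD2l.
- exact: sumr_ge0.
- exact: sumr_ge0.
Qed.

End powR_lemmas.

(** * Positivity, domination and measurability of mixtures and their clusters *)

Section mixtures.
Context {R : realType} {n : nat}.
Implicit Types (v : gaussian_mixture R n) (x : n.-tuple R).

Lemma gm_component_ge0 v i x : 0 <= @gm_component R n v i x.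
Proof.
rewrite /gm_component mulr_ge0 ?(ltW (gm_weight_gt0 i))//.
by rewrite mulr_ge0 ?expR_ge0// invr_ge0 sqrtr_ge0.
Qed.

Lemma gm_fun_ge0 v x : 0 <= gm_fun v x.
Proof. by apply: sumr_ge0 => i _; exact: gm_component_ge0. Qed.

Lemma gm_cluster_ge0 v M (c : 'I_(gm_size v) -> 'I_M) p x :
  0 <= gm_cluster c p x.
Proof. by apply: sumr_ge0 => i _; exact: gm_component_ge0. Qed.

Lemma gm_cluster_partial_sum_le v M (c : 'I_(gm_size v) -> 'I_M) m x :
  (m <= M)%N -> \sum_(p < m) gm_cluster c p x <= gm_fun v x.
Proof.
move=> mM; rewrite (gm_cluster_sum c x).
rewrite -!(big_mkord xpredT (fun p => gm_cluster c p x)) (big_cat_nat (leq0n m) mM)/=.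
by rewrite lerDl sumr_ge0// => p _; exact: gm_cluster_ge0.
Qed.

Lemma gm_cluster_le v M (c : 'I_(gm_size v) -> 'I_M) p x :
  gm_cluster c p x <= gm_fun v x.
Proof.
rewrite /gm_fun (bigID (fun i => c i == p :> nat))/= lerDl sumr_ge0// => i _.
exact: gm_component_ge0.
Qed.

Lemma measurable_gm_component v i : measurable_fun setT (@gm_component R n v i).
Proof.
apply: measurable_funM; first exact: measurable_cst.
apply: measurable_funM; first exact: measurable_cst.
apply: measurableT_comp => //; apply: measurable_funM => //.
apply: measurableT_comp => //.
(* Expanding the quadratic form into coordinates reduces its measurability to that of the maps
   [tnth x k]. *)
rewrite (_ : (fun _ => _) = fun x =>
  \sum_j (\sum_k (tnth x k - tnth (gm_mean i) k) * invmx (gm_cov i) k j) *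
    (tnth x j - tnth (gm_mean i) j)); last first.
  apply/funext => x; rewrite !mxE; apply: eq_bigr => j _; rewrite !mxE.
  by congr (_ * _); apply: eq_bigr => k _; rewrite !mxE.
apply: measurable_sum => j; apply: measurable_funM.
  apply: measurable_sum => k; apply: measurable_funM => //.
  by apply: measurable_funB => //; exact: measurable_tnth.
by apply: measurable_funB => //; exact: measurable_tnth.
Qed.

Lemma measurable_gm_fun v : measurable_fun setT (gm_fun v).
Proof. by apply: measurable_sum => i; exact: measurable_gm_component. Qed.

Lemma measurable_gm_cluster v M (c : 'I_(gm_size v) -> 'I_M) p :
  measurable_fun setT (gm_cluster c p).
Proof.
rewrite (_ : gm_cluster c p = fun x => \sum_(i <- enum (fun i => c i == p :> nat))
    gm_component i x); last first.
  by apply/funext => x; rewrite big_enum.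
by apply: measurable_sum => i; exact: measurable_gm_component.
Qed.

End mixtures.

(** * Supremum and $L^1$ norms, restriction to a piece *)

Section norms.
Context {R : realType}.

Lemma normr_le_supnorm T (f : T -> R) (d : R) x :
  (supnorm f <= d%:E)%E -> `|f x| <= d.
Proof.
rewrite -lee_fin; apply: le_trans.
by apply: ereal_sup_ubound; exists x.
Qed.

Lemma L1normE n (f : n.-tuple R -> R) :
  L1norm f = (\int[lebesgue_tuple R n]_x `|f x|%:E)%E.
Proof. by rewrite /L1norm Lnorm1. Qed.

Lemma restr_funE n (f : n.-tuple R -> R) X x : X x -> restr_fun f X x = f x.
Proof. by move=> Xx; rewrite /restr_fun indicE mem_set// mulr1. Qed.

Lemma measurable_restr_fun n (f : n.-tuple R -> R) X : measurable X ->
  measurable_fun setT f -> measurable_fun setT (restr_fun f X).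
Proof. by move=> mX mf; apply: measurable_funM => //; exact: measurable_indic. Qed.

End norms.

(** * Measurability and integrals of finite sums *)

Lemma measurable_sum_seq d (T : measurableType d) (R : realType) (D : set T)
    (I : eqType) (s : seq I) (f : I -> T -> R) :
  (forall i, i \in s -> measurable_fun D (f i)) ->
  measurable_fun D (fun x => \sum_(i <- s) f i x).
Proof.
(* Replacing [f i] by zero for [i] outside [s] leaves the sum unchanged and makes every summand
   measurable. *)
move=> mf; rewrite (_ : (fun _ => _) =
    fun x => \sum_(i <- s) (if i \in s then f i else cst 0) x); last first.
  by apply/funext => x; apply: eq_big_seq => i ->.
by apply: measurable_sum => i; case: ifPn => // /mf.
Qed.

Lemma integral_sum_le d (T : measurableType d) (R : realType)
    (mu : {measure set T -> \bar R}) (I : eqType) (s : seq I) (f : I -> T -> R)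
    (K : \bar R) :
  (forall i, i \in s -> measurable_fun setT (f i)) ->
  (forall i x, 0 <= f i x) ->
  (forall i, i \in s -> (\int[mu]_x (f i x)%:E <= K)%E) ->
  (\int[mu]_x (\sum_(i <- s) f i x)%:E <= (size s)%:R%:E * K)%E.
Proof.
move=> + f0; elim: s => [|i s IH] mf fK.
  by under eq_integral do rewrite big_nil; rewrite integral0 mul0e.
under eq_integral do rewrite big_cons EFinD.
have ms : measurable_fun setT (fun x => \sum_(i <- s) f i x).
  by apply: measurable_sum_seq => j js; apply: mf; rewrite inE js orbT.
rewrite ge0_integralD//=.
(* Distributing $(1+k)K$ is sound for any extended real [K], because both coefficients are
   nonnegative. *)
- rewrite -nat1r EFinD ge0_muleDl// mul1e leeD//.
    by apply: fK; rewrite mem_head.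
  by apply: IH => j js; [apply: mf|apply: fK]; rewrite inE js orbT.
- by move=> x _; rewrite lee_fin.
- by apply/measurable_EFinP; apply: mf; rewrite mem_head.
- by move=> x _; rewrite lee_fin sumr_ge0.
- exact/measurable_EFinP.
Qed.

(** * Pointwise and integrated error of the parallelized fusion *)

Theorem proposition1 (R : realType) (n : nat)
    (v1 v2 : gaussian_mixture R n) (w1 w2 : R) (M1 M2 Q : nat)
    (c1 : 'I_(gm_size v1) -> 'I_M1) (c2 : 'I_(gm_size v2) -> 'I_M2)
    (X : nat -> set (n.-tuple R)) (delta : R) :
  let M := (M1 + M2 - Q)%N in
  let v1p p := restr_fun (gm_fun v1) (X p) in
  let v2p p := restr_fun (gm_fun v2) (X p) in
  let hv1 := gm_cluster c1 in
  let hv2 := gm_cluster c2 in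
  0 < w1 -> 0 < w2 -> w1 + w2 = 1 ->
  (Q <= minn M1 M2)%N ->
  (forall p, (p < M)%N -> measurable (X p)) ->
  trivIset `I_M X ->
  \bigcup_(p in `I_M) X p = [set: n.-tuple R] ->
  0 <= delta ->
  (forall p, (p < M1)%N ->
     (supnorm (fun x => (v1p p x - hv1 p x)%R) <= delta%:E)%E) ->
  (forall p, (M1 <= p < M)%N -> (supnorm (v1p p) <= delta%:E)%E) ->
  (forall p, (p < Q)%N ->
     (supnorm (fun x => (v2p p x - hv2 p x)%R) <= delta%:E)%E) ->
  (forall p, (Q <= p < M1)%N -> (supnorm (v2p p) <= delta%:E)%E) ->
  (forall p, (M1 <= p < M)%N ->
     (supnorm (fun x => (v2p p x - hv2 (p - M1 + Q)%N x)%R) <= delta%:E)%E) ->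
  bounded_fun (fun x => gm_fun v1 x `^ w1) ->
  bounded_fun (fun x => gm_fun v2 x `^ w2) ->
  let K := (\big[maxe/-oo]_(p < M) \big[maxe/-oo]_(q < M)
              maxe (L1norm (fun x => (v1p p x `^ w1)%R))
                   (L1norm (fun x => (v2p q x `^ w2)%R)))%E in
  let v12 x := gm_fun v1 x `^ w1 * gm_fun v2 x `^ w2 in
  let hv12 x := \sum_(p < Q) hv1 p x `^ w1 * hv2 p x `^ w2 in
  (L1norm (fun x => (hv12 x - v12 x)%R) <=
     M2%:R%:E * K * (delta `^ w1)%:E +
     (2 * Q + M1)%:R%:E * K * (delta `^ w2)%:E)%E.
Proof.
move=> M v1p v2p hv1 hv2 w1_gt0 w2_gt0 w12 Qmin mX _ coverX d0.
move=> near1 far1 near2 far2 _ _ _; cbv zeta.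
set K := (\big[_/_]_(p < M) _)%E.
pose v12 x := gm_fun v1 x `^ w1 * gm_fun v2 x `^ w2.
pose hv12 x := \sum_(p < Q) hv1 p x `^ w1 * hv2 p x `^ w2.
rewrite -/(L1norm (fun x => hv12 x - v12 x)).
have [QM1 QM2] : (Q <= M1)%N /\ (Q <= M2)%N by apply/andP; rewrite -leq_min.
have M1M : (M1 <= M)%N by rewrite /M -addnBA// leq_addr.
have w1_01 : 0 <= w1 <= 1 by lra.
have w2_01 : 0 <= w2 <= 1 by lra.
have fused_le x : hv12 x <= v12 x.
  apply: le_trans (hoelder_sum _ _ _ _ _ _ _ _ _ _ _) _ => //.
  - by move=> p; exact: gm_cluster_ge0.
  - by move=> p; exact: gm_cluster_ge0.
  apply: ler_pM; rewrite ?powR_ge0// le_powR ?(ltW w1_gt0) ?(ltW w2_gt0)//;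
    rewrite ?gm_cluster_partial_sum_le ?sumr_ge0// => p _;
    exact: gm_cluster_ge0.
(* [s1] and [s2] list the pieces on which clusters of $v^1$ and of $v^2$ are concentrated. Since $M
   = M_1 + (M_2 - Q)$, all indices are below $M$; the lengths $M_1$ and $M_2$ become the constants
   of the bound. *)
pose s1 := iota 0 M1; pose s2 := iota 0 Q ++ iota M1 (M2 - Q).
have s1M p : p \in s1 -> (p < M)%N.
  by rewrite mem_iota => /andP[_]; rewrite add0n => /leq_trans; exact.
have s2M p : p \in s2 -> (p < M)%N.
  rewrite mem_cat !mem_iota add0n addnBA// => /orP[/= pQ|/andP[]//].
  by apply: leq_trans pQ _; exact: leq_trans M1M.
(* [h1] and [h2] are globally defined and nonnegative; they dominate $[v^1]^{w_1}$ and $[v^2]^{w_2}$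
   on the pieces of [s1] and [s2], so one pointwise bound can serve all pieces. *)
pose h1 x := \sum_(p <- s1) v1p p x `^ w1.
pose h2 x := \sum_(p <- s2) v2p p x `^ w2.
have h1_ge x q : q \in s1 -> X q x -> gm_fun v1 x `^ w1 <= h1 x.
  move=> qs Xqx; rewrite /h1 (big_rem q)//= /v1p restr_funE// lerDl.
  by rewrite sumr_ge0// => p _; exact: powR_ge0.
have h2_ge x q : q \in s2 -> X q x -> gm_fun v2 x `^ w2 <= h2 x.
  move=> qs Xqx; rewrite /h2 (big_rem q)//= /v2p restr_funE// lerDl.
  by rewrite sumr_ge0// => p _; exact: powR_ge0.
have h1_ge0 x : 0 <= h1 x by apply: sumr_ge0 => p _; exact: powR_ge0.
have h2_ge0 x : 0 <= h2 x by apply: sumr_ge0 => p _; exact: powR_ge0.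
have hv12_ge0 x : 0 <= hv12 x.
  by apply: sumr_ge0 => p _; rewrite mulr_ge0 ?powR_ge0.
have error_le x : `|hv12 x - v12 x| <= delta `^ w1 * h2 x + delta `^ w2 * h1 x.
  rewrite distrC ger0_norm ?subr_ge0//.
  have [q qM Xqx] : (\bigcup_(p in `I_M) X p) x by rewrite coverX.
  (* Matched piece: [q] lies in both lists, so both majorants are available. *)
  have [qQ|Qq] := ltnP q Q.
    have qs1 : q \in s1 by rewrite mem_iota/= add0n (leq_trans qQ).
    have qs2 : q \in s2 by rewrite mem_cat mem_iota/= add0n qQ.
    have hv12q : hv1 q x `^ w1 * hv2 q x `^ w2 <= hv12 x.
      rewrite /hv12 (bigD1 (Ordinal qQ))//= lerDl sumr_ge0// => p _.
      by rewrite mulr_ge0 ?powR_ge0.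
    have := normr_le_supnorm _ _ _ x (near1 q (leq_trans qQ QM1)).
    rewrite /v1p restr_funE// => /ler_normlW n1.
    have := normr_le_supnorm _ _ _ x (near2 q qQ).
    rewrite /v2p restr_funE// => /ler_normlW n2.
    have A_le := powR_le_addB _ _ _ _ w1_01 (gm_fun_ge0 v1 x)
      (gm_cluster_ge0 v1 _ c1 q x) n1 d0.
    have B_le := powR_le_addB _ _ _ _ w2_01 (gm_fun_ge0 v2 x)
      (gm_cluster_ge0 v2 _ c2 q x) n2 d0.
    have a_le : hv1 q x `^ w1 <= gm_fun v1 x `^ w1.
      by rewrite le_powR ?(ltW w1_gt0) ?(ltW w2_gt0) ?gm_cluster_ge0 ?gm_cluster_le.
    have b_le : hv2 q x `^ w2 <= gm_fun v2 x `^ w2.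
      by rewrite le_powR ?(ltW w1_gt0) ?(ltW w2_gt0) ?gm_cluster_ge0 ?gm_cluster_le.
    (* With $a, b$ the values of the [q]-th clusters, [e1] and [e2] bound the two terms of
       $A^{w_1}B^{w_2} - a^{w_1}b^{w_2} = (A^{w_1}-a^{w_1})B^{w_2} + (B^{w_2}-b^{w_2})a^{w_1}$. *)
    have e1 : (gm_fun v1 x `^ w1 - hv1 q x `^ w1) * gm_fun v2 x `^ w2 <=
        delta `^ w1 * h2 x.
      apply: ler_pM; rewrite ?subr_ge0 ?powR_ge0// ?(h2_ge _ q)//.
      by rewrite lerBlDl.
    have e2 : (gm_fun v2 x `^ w2 - hv2 q x `^ w2) * hv1 q x `^ w1 <=
        delta `^ w2 * h1 x.
      apply: ler_pM; rewrite ?subr_ge0 ?powR_ge0//; first by rewrite lerBlDl.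
      exact: le_trans a_le (h1_ge _ q _ _).
    rewrite /v12; lra.
  apply: (@le_trans _ _ (v12 x)); first by rewrite gerBl.
  (* For $Q \le q < M_1$, $v^2$ is small and [h1] controls the other factor; for $q \ge M_1$, $v^1$
     is small and [h2] does. *)
  rewrite /v12; have [qM1|M1q] := ltnP q M1.
    have B_le : gm_fun v2 x <= delta.
      have := normr_le_supnorm _ _ _ x (far2 q (introT andP (conj Qq qM1))).
      by rewrite /v2p restr_funE// => /(le_trans (ler_norm _)).
    apply: ler_wpDl; first by rewrite mulr_ge0 ?powR_ge0.
    rewrite mulrC ler_pM ?powR_ge0 ?le_powR ?gm_fun_ge0 ?(ltW w1_gt0) ?(ltW w2_gt0)//.
    by rewrite (h1_ge _ q)// mem_iota.
  have A_le : gm_fun v1 x <= delta.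
    have := normr_le_supnorm _ _ _ x (far1 q (introT andP (conj M1q qM))).
    by rewrite /v1p restr_funE// => /(le_trans (ler_norm _)).
  apply: ler_wpDr; first by rewrite mulr_ge0 ?powR_ge0.
  rewrite ler_pM ?powR_ge0 ?le_powR ?gm_fun_ge0 ?(ltW w1_gt0) ?(ltW w2_gt0)//.
  by rewrite (h2_ge _ q)// mem_cat [in X in _ || X]mem_iota M1q addnBA ?qM ?orbT.
have mv12 : measurable_fun setT (fun x => hv12 x - v12 x).
  apply: measurable_funB.
    apply: measurable_sum => p; apply: measurable_funM;
      by apply: (measurableT_comp (measurable_powR _)) => //;
        exact: measurable_gm_cluster.
  apply: measurable_funM;
    by apply: (measurableT_comp (measurable_powR _)) => //;
      exact: measurable_gm_fun.
have mv1p p : (p < M)%N -> measurable_fun setT (fun x => v1p p x `^ w1).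
  move=> pM; apply: (measurableT_comp (measurable_powR _)) => //.
  by apply: measurable_restr_fun; [exact: mX|exact: measurable_gm_fun].
have mv2p p : (p < M)%N -> measurable_fun setT (fun x => v2p p x `^ w2).
  move=> pM; apply: (measurableT_comp (measurable_powR _)) => //.
  by apply: measurable_restr_fun; [exact: mX|exact: measurable_gm_fun].
have K_ge p q : (p < M)%N -> (q < M)%N ->
    (maxe (L1norm (fun x => (v1p p x `^ w1)%R))
          (L1norm (fun x => (v2p q x `^ w2)%R))
      <= K)%E.
  move=> pM qM; rewrite /K.
  apply: (@bigmax_sup _ _ _ _ (Ordinal pM)) => //.
  exact: (@bigmax_sup _ _ _ _ (Ordinal qM)).
have K1 p : (p < M)%N ->
    (\int[lebesgue_tuple R n]_x (v1p p x `^ w1)%:E <= K)%E.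
  move=> pM; apply: le_trans (K_ge p p pM pM); rewrite le_max; apply/orP; left.
  by rewrite L1normE; under [leRHS]eq_integral do rewrite ger0_norm ?powR_ge0//.
have K2 p : (p < M)%N ->
    (\int[lebesgue_tuple R n]_x (v2p p x `^ w2)%:E <= K)%E.
  move=> pM; apply: le_trans (K_ge p p pM pM); rewrite le_max; apply/orP; right.
  by rewrite L1normE; under [leRHS]eq_integral do rewrite ger0_norm ?powR_ge0//.
(* An empty maximum would be [-oo]. The zero vector lies in some piece, so $M > 0$ and [K] dominates
   the integral of a nonnegative function. *)
have K0 : (0 <= K)%E.
  have [q qM _] : (\bigcup_(p in `I_M) X p) [tuple of nseq n 0] by rewrite coverX.
  apply: le_trans (K1 q qM); apply: integral_ge0 => x _.
  by rewrite lee_fin powR_ge0.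
have I1 : (\int[lebesgue_tuple R n]_x (h1 x)%:E <= M1%:R%:E * K)%E.
  rewrite -[in X in (_ <= X)%E](size_iota 0 M1).
  by apply: integral_sum_le => p => [/s1M/mv1p|x|/s1M/K1]//; exact: powR_ge0.
have I2 : (\int[lebesgue_tuple R n]_x (h2 x)%:E <= M2%:R%:E * K)%E.
  rewrite [in X in (_ <= X)%E](_ : M2 = size s2); last first.
    by rewrite size_cat !size_iota subnKC.
  by apply: integral_sum_le => p => [/s2M/mv2p|x|/s2M/K2]//; exact: powR_ge0.
have mh1 : measurable_fun setT h1.
  by apply: measurable_sum_seq => p /s1M /mv1p.
have mh2 : measurable_fun setT h2.
  by apply: measurable_sum_seq => p /s2M /mv2p.
rewrite L1normE; apply: (@le_trans _ _
    (\int[lebesgue_tuple R n]_x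
      ((delta `^ w1)%:E * (h2 x)%:E + (delta `^ w2)%:E * (h1 x)%:E))%E).
  apply: ge0_le_integral => //=.
  - by apply/measurable_EFinP; exact: measurableT_comp.
  - by apply: emeasurable_funD; apply: measurable_funeM; exact/measurable_EFinP.
  - by move=> x _; rewrite -!EFinM -EFinD lee_fin; exact: error_le.
(* Linearity is applied to nonnegative functions, so infinite integrals are allowed. *)
have int_split : (\int[lebesgue_tuple R n]_x
    ((delta `^ w1)%:E * (h2 x)%:E + (delta `^ w2)%:E * (h1 x)%:E) =
    (delta `^ w1)%:E * \int[lebesgue_tuple R n]_x (h2 x)%:E +
    (delta `^ w2)%:E * \int[lebesgue_tuple R n]_x (h1 x)%:E)%E.
  have ge0Z w h x : (forall y, 0 <= h y) ->
      (0 <= (delta `^ w)%:E * (h x : R)%:E)%E.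
    by move=> h0; rewrite -EFinM lee_fin mulr_ge0 ?powR_ge0.
  rewrite ge0_integralD// ?ge0_integralZl_EFin ?powR_ge0//;
    by [exact/measurable_EFinP
       |apply: measurable_funeM; exact/measurable_EFinP
       |move=> x _; rewrite ?ge0Z ?lee_fin].
rewrite int_split.
rewrite ![(_ * _ * (_ `^ _)%:E)%E]muleC leeD ?lee_wpmul2l ?lee_fin ?powR_ge0//.
(* Here $M_1 K$ is enlarged to $(2Q+M_1)K$, which relies on [K0]. *)
apply: le_trans I1 _; rewrite lee_wpmul2r// lee_fin ler_nat.
exact: leq_addl.
Qed.
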